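(* The geometric dual is involutory: if $\mathcal{C}$ is a (nondegenerate) $[\mathbf{n},k]_{q^m/q}$ sum-rank metric code with associated system $(U_1,\ldots,U_t)$ such that $U_1\cap\cdots\cap U_t$ contains no $1$-dimensional $\mathbb{F}_{q^m}$-subspace of $\mathbb{F}_{q^m}^k$, then $(\mathcal{C}^{\perp_{\mathcal{G}}})^{\perp_{\mathcal{G}}}$ is equivalent to $\mathcal{C}$.
   Context: Let $q$ be a prime power and $\mathbf{n}=(n_1,\ldots,n_t)$, $\mathbb{F}_{q^m}^{\mathbf{n}}=\bigoplus_{i=1}^t\mathbb{F}_{q^m}^{n_i}$ (order of block lengths is immaterial here). The rank of $v\in\mathbb{F}_{q^m}^n$ is the $\mathbb{F}_q$-dimension of the $\mathbb{F}_q$-span of its entries; the sum-rank weight of $x=(x_1,\ldots,x_t)$ is $w(x)=\sum_i\mathrm{rk}(x_i)$ and the distance is $w(x-y)$. An $[\mathbf{n},k]_{q^m/q}$ code is a $k$-dimensional $\mathbb{F}_{q^m}$-subspace of $\mathbb{F}_{q^m}^{\mathbf{n}}$. A generator matrix is $G=(G_1|\cdots|G_t)$ with $G_i\in\mathbb{F}_{q^m}^{k\times n_i}$ and rows a basis of the code; the code is nondegenerate if the columns of each $G_i$ are $\mathbb{F}_q$-independent. All codes are assumed nondegenerate. Two codes are equivalent if one is mapped to the other by an $\mathbb{F}_{q^m}$-linear isometry of the ambient space, i.e. a map $(x_1,\ldots,x_t)\mapsto(a_1x_{\pi(1)}A_1,\ldots,a_tx_{\pi(t)}A_t)$ with $a_i\in\mathbb{F}_{q^m}^*$,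 $A_i\in\mathrm{GL}(n_i,\mathbb{F}_q)$ and $\pi$ a permutation of blocks of equal length. Systems: an $[\mathbf{n},k]_{q^m/q}$-system is an ordered tuple $(U_1,\ldots,U_t)$ of $\mathbb{F}_q$-subspaces of $\mathbb{F}_{q^m}^k$ with $\dim_{\mathbb{F}_q}U_i=n_i$ and $\langle U_1,\ldots,U_t\rangle_{\mathbb{F}_{q^m}}=\mathbb{F}_{q^m}^k$. If $G=(G_1|\cdots|G_t)$ generates $\mathcal{C}$ and $U_i$ is the $\mathbb{F}_q$-span of the columns of $G_i$, then $(U_1,\ldots,U_t)$ is a system associated with $\mathcal{C}$. Conversely, a code associated with a system is one generated by $(G_1|\cdots|G_t)$ where the columns of $G_i$ form an $\mathbb{F}_q$-basis of $U_i$. Geometric dual: fix a nondegenerate reflexive sesquilinear form $\sigma$ on $V=\mathbb{F}_{q^m}^k$ and let $\sigma'(x,y)=\mathrm{Tr}_{q^m/q}(\sigma(x,y))$, regarded as a nondegenerate reflexive sesquilinear form on $V$ seen as a $km$-dimensional $\mathbb{F}_q$-space. For an $\mathbb{F}_q$-subspace $U$ of $V$ let $U^{\perp'}$ be its orthogonal complement with respect to $\sigma'$. If $\mathcal{C}$ has associated system $(U_1,\ldots,U_t)$ such that $U_1\cap\cdots\cap U_t$ contains no $1$-dimensional $\mathbb{F}_{q^m}$-subspace, a geometric dual $\mathcal{C}^{\perp_{\mathcal{G}}}$ is any code associated with the system $(U_1^{\perp'},\ldots,U_t^{\perp'})$; it is determined up to equivalence.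
   Formalization: For k = 1, where every sesquilinear form is trivially reflexive, the field automorphism accompanying σ is additionally required to be an involution; without this the trace form need not be reflexive and the claim can fail. *)

(* Defs.v *)
From HB Require Import structures.
From mathcomp Require Import all_boot all_order all_fingroup all_algebra all_field.

Set Implicit Arguments.
Unset Strict Implicit.
Unset Printing Implicit Defensive.

Import GRing.Theory.
Local Open Scope ring_scope.

(* F stands for F_q and L for F_{q^m}, with m = \dim {:L}. *)

(* L^k viewed as a vector space over F; it is convertible to 'cV[L]_k, which
   carries the L-space structure. *)
Definition fcol (F : fieldType) (L : fieldExtType F) (k : nat) : Type :=
  'cV[L]_k.

Section FCol.
Variables (F : fieldType) (L : fieldExtType F) (k : nat).

HB.instance Definition _ := GRing.Zmodule.copy (fcol L k) 'cV[L]_k.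

Definition fcol_scale (c : F) (v : fcol L k) : fcol L k :=
  c%:A *: (v : 'cV[L]_k).

Fact fcol_scaleA a b v : fcol_scale a (fcol_scale b v) = fcol_scale (a * b) v.
Proof. by rewrite /fcol_scale scalerA -in_algE -rmorphM. Qed.
Fact fcol_scale1 : left_id 1 fcol_scale.
Proof. by move=> v; rewrite /fcol_scale scale1r [LHS]scale1r. Qed.
Fact fcol_scaleDr : right_distributive fcol_scale +%R.
Proof. by move=> c u v; rewrite /fcol_scale [LHS]scalerDr. Qed.
Fact fcol_scaleDl v : {morph fcol_scale^~ v : a b / a + b}.
Proof. by move=> a b; rewrite /fcol_scale scalerDl [LHS]scalerDl. Qed.

HB.instance Definition _ := GRing.Zmodule_isLmodule.Build F (fcol L k)
  fcol_scaleA fcol_scale1 fcol_scaleDr fcol_scaleDl.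

Definition fcol_v2r (v : fcol L k) : 'rV[F]_(k * \dim {:L}) :=
  mxvec (\matrix_(i, j) coord (vbasis {:L}) j ((v : 'cV[L]_k) i 0)).
Definition fcol_r2v (r : 'rV[F]_(k * \dim {:L})) : fcol L k :=
  \col_i \sum_j vec_mx r i j *: (vbasis {:L})`_j.

Fact fcol_vect_axiom : Vector.axiom (k * \dim {:L}) (fcol L k).
Proof.
exists fcol_v2r.
  move=> a u v; rewrite /fcol_v2r -linearP; congr mxvec.
  apply/matrixP=> i j; rewrite !mxE -linearP; congr (coord _ _ _).
  by rewrite /fcol_scale mulr_algl.
exists fcol_r2v => [v | r].
  apply/matrixP=> i j; rewrite ord1 !mxE [RHS](coord_vbasis (memvf _)).
  by apply: eq_bigr => l _; rewrite mxvecK mxE.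
apply: (canLR vec_mxK); apply/matrixP=> i j; rewrite !mxE.
have /coord_sum_free-> : free (vbasis {:L}) := basis_free (vbasisP _).
by rewrite mxE.
Qed.
HB.instance Definition _ :=
  Lmodule_hasFinDim.Build F (fcol L k) fcol_vect_axiom.
End FCol.

Section SumRank.
Variables (F : fieldType) (L : fieldExtType F) (t : nat).

(* The ambient space of block lengths n; block i of x is submxrow x i. *)
Definition ambient (n : 'I_t -> nat) := 'rV[L]_(\sum_i n i).

Definition rank_weight l (x : 'rV[L]_l) : nat :=
  \dim <<[seq x 0 j | j : 'I_l]>>.

Definition sum_rank_weight (n : 'I_t -> nat) (x : ambient n) : nat :=
  (\sum_i rank_weight (submxrow x i))%N.

Definition isometry_form (n n' : 'I_t -> nat) (f : ambient n -> ambient n') :=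
  exists (s : 'S_t) (hs : forall i, n (s i) = n' i)
         (a : 'I_t -> L) (A : forall i, 'M[F]_(n' i)),
    [/\ forall i, a i != 0,
        forall i, A i \in unitmx &
        forall x i, submxrow (f x) i =
          a i *: (castmx (erefl 1, hs i) (submxrow x (s i))
                    *m map_mx (in_alg L) (A i))].

(* The block lengths n and n' are allowed to be distinct terms, because those of
   a double dual are only provably equal to the original ones. *)
Definition equivalent_codes (n n' : 'I_t -> nat)
    (C : {vspace ambient n}) (C' : {vspace ambient n'}) :=
  exists f : 'Hom(ambient n, ambient n'),
    [/\ bijective f,
        forall x, sum_rank_weight (f x) = sum_rank_weight x,
        isometry_form f &
        (f @: C)%VS = C'].

Variable k : nat.

Definition generator_matrix (n : 'I_t -> nat)
    (G : 'M[L]_(k, \sum_i n i)) (C : {vspace ambient n}) :=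
  basis_of C [seq row i G | i : 'I_k].

Definition fcolumns l (M : 'M[L]_(k, l)) : seq (fcol L k) :=
  [seq (col j M : fcol L k) | j : 'I_l].

Definition nondegenerate_code (n : 'I_t -> nat) (C : {vspace ambient n}) :=
  forall G, generator_matrix G C -> forall i, free (fcolumns (submxrow G i)).

Definition is_system (n : 'I_t -> nat) (U : 'I_t -> {vspace fcol L k}) :=
  (forall i, \dim (U i) = n i) /\
  (forall W : {vspace 'cV[L]_k},
     (forall i (v : 'cV[L]_k), v \in U i -> v \in W) -> W = fullv).

Definition system_of_code (n : 'I_t -> nat) (C : {vspace ambient n})
    (U : 'I_t -> {vspace fcol L k}) :=
  exists2 G, generator_matrix G C &
    forall i, U i = <<fcolumns (submxrow G i)>>%VS.

Definition code_of_system (n : 'I_t -> nat) (U : 'I_t -> {vspace fcol L k})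
    (C : {vspace ambient n}) :=
  exists2 G, generator_matrix G C &
    forall i, basis_of (U i) (fcolumns (submxrow G i)).

Definition no_common_line (U : 'I_t -> {vspace fcol L k}) :=
  ~ exists2 W : {vspace 'cV[L]_k}, \dim W = 1%N &
      forall v : 'cV[L]_k, v \in W -> forall i, v \in U i.

End SumRank.

Section Forms.
Variables (L : fieldType) (k : nat) (theta : {rmorphism L -> L}).
Variable sigma : {bilinear 'cV[L]_k -> 'cV[L]_k -> L | *%R & theta \; *%R}.

Definition nondegenerate_form :=
  forall x, (forall y, sigma x y = 0) -> x = 0.

(* For 1 < k, a nondegenerate reflexive form has an involutive companion theta
   and sigma y x is a fixed scalar multiple of theta (sigma x y).  For k = 1
   every form is reflexive, whatever theta is, and involutivity of theta has to
   be required separately. *)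
Definition reflexive_form := forall x y, sigma x y = 0 -> sigma y x = 0.
End Forms.

Section GeometricDual.
Variables (F : finFieldType) (L : splittingFieldType F) (t k : nat).
Variable theta : {rmorphism L -> L}.
Variable sigma : {bilinear 'cV[L]_k -> 'cV[L]_k -> L | *%R & theta \; *%R}.

(* Values in F, embedded in L. *)
Definition trace_form (x y : fcol L k) : L := galTrace 1%AS {:L} (sigma x y).

(* W is the orthogonal complement of U with respect to trace_form. *)
Definition orthogonal_complement (U W : {vspace fcol L k}) :=
  forall v, v \in W <-> (forall u, u \in U -> trace_form u v = 0).

(* The dual is defined up to equivalence only, hence a relation: D is a
   geometric dual of C. *)
Definition geometric_dual (n n' : 'I_t -> nat)
    (C : {vspace ambient L n}) (D : {vspace ambient L n'}) :=
  exists U U' : 'I_t -> {vspace fcol L k},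
    [/\ system_of_code C U, no_common_line U,
        forall i, orthogonal_complement (U i) (U' i),
        is_system n' U' & code_of_system U' D].
End GeometricDual.

(* Main.v *)
(* With M the Gram matrix of sigma, sigma x y = x^T M theta(y).  Reflexivity is
   used only to get theta^2 = 1; then sigma (phi x) y = theta (sigma y x) for an
   L-linear bijection phi, and since the trace commutes with theta, left and
   right orthogonality for the trace form differ by phi.  Trace duality makes
   every F-subspace its own biorthogonal, so the double dual of the system
   (U_i) is (P^-1 U_i) for a single P in GL_k(L), where P also accounts for
   the change of basis between generator matrices of the dual code.  Thus P^-1 G
   and a generator matrix of the double dual have blocks whose columns span the
   same F-spaces, i.e. blocks that differ by invertible matrices over F. *)
From HB Require Import structures.
Require Import Defs.
From mathcomp Require Import all_boot all_order all_fingroup all_algebra all_field.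

Set Implicit Arguments.
Unset Strict Implicit.
Unset Printing Implicit Defensive.

Import GRing.Theory.
Local Open Scope ring_scope.

(** * The trace from L to F *)

Section Trace.
Variables (F : finFieldType) (L : splittingFieldType F).
Implicit Types (a b c : L) (theta : {rmorphism L -> L}).

Local Notation tr := (galTrace 1%AS {:L}).

Lemma trE a : tr a = \sum_(g in 'Gal({:L} / 1)%g) g a.
Proof. by []. Qed.

(* The Galois group is generated by a power map, with which every ring
   endomorphism commutes. *)
Lemma rmorph_tr theta a : theta (tr a) = tr (theta a).
Proof.
have [alpha /eqP galE alphaE] := finField_galois_generator (sub1v {:L}%AS).
rewrite !trE rmorph_sum /=; apply: eq_bigr => g; rewrite galE => /cycleP[i ->].
elim: i a => [|i IHi] b; first by rewrite expg0 !gal_id.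
rewrite expgS !galM ?memvf // IHi; congr ((alpha ^+ i)%g _).
by rewrite !alphaE ?memvf // rmorphXn.
Qed.

(** Dedekind independence: the sum of the Galois automorphisms is not the zero map, and for nonzero
    [a] every element of L is a multiple [c * a]. *)
Lemma tr_nondeg a : (forall c, tr (c * a) = 0) -> a = 0.
Proof.
move=> tr0; apply/eqP/idPn => a0.
have [b _] := @gal_independent_contra _ _ {:L}%AS (mem 'Gal({:L} / 1)%g)
  (fun=> 1) 1%g (group1 _) (oner_neq0 _).
rewrite (eq_bigr (fun g : gal_of {:L} => g (b / a * a))) => [|g _].
  by rewrite -trE tr0 eqxx.
by rewrite mul1r divfK.
Qed.

Lemma trZ (x : F) a : tr (x *: a) = x *: tr a.
Proof. by rewrite !trE scaler_sumr; apply: eq_bigr => g _; rewrite linearZ. Qed.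

Lemma tr_in1 a : exists x : F, tr a = x%:A.
Proof.
apply/vlineP; apply: mem_galTrace (memvf a); apply: finField_galois.
exact: sub1v.
Qed.
End Trace.

(** * The standard dot product on columns *)

Section Dot.
Variables (R : comNzRingType) (k : nat).
Implicit Types (x y z : 'cV[R]_k) (Q : 'M[R]_k).

Definition dot x y : R := (x^T *m y) 0 0.

Lemma dotE x y : dot x y = \sum_i x i 0 * y i 0.
Proof. by rewrite /dot mxE; apply: eq_bigr => i _; rewrite mxE. Qed.

Lemma dotC x y : dot x y = dot y x.
Proof. by rewrite !dotE; apply: eq_bigr => i _; rewrite mulrC. Qed.

Lemma dotDl x y z : dot (x + y) z = dot x z + dot y z.
Proof. by rewrite /dot linearD mulmxDl mxE. Qed.

Lemma dotZl a x y : dot (a *: x) y = a * dot x y.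
Proof. by rewrite /dot linearZ -scalemxAl mxE. Qed.

Lemma dotZr a x y : dot x (a *: y) = a * dot x y.
Proof. by rewrite dotC dotZl dotC. Qed.

Lemma dot0l y : dot 0 y = 0.
Proof. by rewrite -(scale0r (0 : 'cV[R]_k)) dotZl mul0r. Qed.

Lemma dot_mull Q x y : dot (Q *m x) y = dot x (Q^T *m y).
Proof. by rewrite /dot trmx_mul mulmxA. Qed.

Lemma dot_deltal i y : dot (delta_mx i 0) y = y i 0.
Proof. by rewrite /dot trmx_delta -rowE mxE. Qed.

Lemma dot_nondeg y : (forall x, dot x y = 0) -> y = 0.
Proof.
by move=> y0; apply/matrixP => i j; rewrite ord1 -dot_deltal y0 mxE.
Qed.
End Dot.

(** * Trace duality on L^k over F *)

Section Duality.
Variables (F : finFieldType) (L : splittingFieldType F) (k : nat).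
Local Notation tr := (galTrace 1%AS {:L}).
Local Notation V := (fcol L k).

Lemma fcol_scaleE (c : F) (v : V) : c *: v = c%:A *: (v : 'cV[L]_k).
Proof. by []. Qed.

Lemma dot_fscalel (c : F) (x : V) (y : 'cV[L]_k) :
  dot (c *: x) y = c *: dot x y.
Proof. by rewrite fcol_scaleE dotZl mulr_algl. Qed.

Lemma tr_dot_nondeg (y : 'cV[L]_k) : (forall x, tr (dot x y) = 0) -> y = 0.
Proof.
move=> y0; apply: dot_nondeg => x; apply: tr_nondeg => c.
by rewrite -dotZl y0.
Qed.

(** [galTrace] takes its values in L, on the line spanned by 1; the coordinate on that line gives a
    form with values in F itself. *)
Definition trF (a : L) : F := coord [tuple (1 : L)] 0 (tr a).

Lemma trFE a : tr a = (trF a)%:A.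
Proof.
rewrite [LHS](@coord_span _ _ _ [tuple (1 : L)]) ?big_ord1 //=.
by have [x ->] := tr_in1 a; rewrite span_seq1; apply/vlineP; exists x.
Qed.

Lemma trF_eq0 a : (trF a == 0) = (tr a == 0).
Proof. by rewrite trFE scaler_eq0 oner_eq0 orbF. Qed.

Fact trF_is_linear : linear (trF : L -> F^o).
Proof. by move=> c a b; rewrite /trF [tr _]raddfD /= trZ linearP. Qed.
HB.instance Definition _ := GRing.isLinear.Build F L F^o _ trF trF_is_linear.

Definition tr_form (y x : V) : F^o := trF (dot x y).

Fact tr_form_is_linear y : linear (tr_form y).
Proof. by move=> c a b; rewrite /tr_form dotDl dot_fscalel linearP. Qed.
HB.instance Definition _ y :=
  GRing.isLinear.Build F V F^o _ (tr_form y) (tr_form_is_linear y).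

Definition tr_dual (y : V) : 'Hom(V, F^o) := linfun (tr_form y).

Fact tr_dual_is_linear : linear tr_dual.
Proof.
move=> c a b; apply/lfunP => x.
rewrite !lfunE /= [X in _ = X + _]lfunE /= !lfunE /=.
by rewrite /tr_form dotC dotDl dot_fscalel linearP ![dot x _]dotC.
Qed.
HB.instance Definition _ :=
  GRing.isLinear.Build F V 'Hom(V, F^o) _ tr_dual tr_dual_is_linear.

(* tr_dual is injective between spaces of the same dimension. *)
Lemma tr_dual_surj (f : 'Hom(V, F^o)) : exists y, f = tr_dual y.
Proof.
have ker0 : lker (linfun tr_dual) == 0%VS.
  rewrite -subv0; apply/subvP => y.
  rewrite memv_ker lfunE memv0 => /eqP /lfunP y0.
  apply/eqP/tr_dot_nondeg => x; apply/eqP; rewrite -trF_eq0.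
  by have := y0 x; rewrite !lfunE /= => /eqP.
have: f \in limg (linfun tr_dual).
  suff -> : limg (linfun tr_dual) = fullv by apply: memvf.
  apply/eqP; rewrite eqEdim subvf limg_dim_eq ?(eqP ker0) ?capv0 // !dimvf.
  exact: eq_leq (muln1 _).
by case/memv_imgP => y _ ->; exists y; rewrite lfunE.
Qed.

(** The functional sending x to the trace of [dot (x - projv U x) y] kills [U] and is represented by
    some z, to which the hypothesis applies. Hence [w - projv U w] is trace-orthogonal to every
    [y]. *)
Lemma mem_biorthogonal (U : {vspace V}) (w : V) :
  (forall y, (forall u, u \in U -> tr (dot u y) = 0) -> tr (dot w y) = 0) ->
  w \in U.
Proof.
move=> wU; suff /eqP : w - projv U w = 0.
  by rewrite subr_eq0 => /eqP ->; apply: memv_proj.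
apply: tr_dot_nondeg => y; rewrite dotC.
have [z zE] := tr_dual_surj (tr_dual y \o (\1 - projv U))%VF.
have zP x : tr (dot x z) = tr (dot (x - projv U x) y).
  have /(congr1 (fun f : 'Hom(V, F^o) => f x)) := zE.
  rewrite comp_lfunE add_lfunE opp_lfunE id_lfunE !lfunE /= => E.
  by rewrite !trFE -[trF (dot x z)]E.
rewrite -zP; apply: wU => u uU.
by rewrite zP projv_id // subrr dot0l raddf0.
Qed.
End Duality.

Lemma row_free_ker (K : fieldType) m n (A : 'M[K]_(m, n)) :
  row_free A <-> (forall r : 'rV_m, r *m A = 0 -> r = 0).
Proof.
split=> [Afree r rA0 | A0].
  by apply: (row_free_inj Afree); rewrite rA0 mul0mx.
by rewrite -kermx_eq0; apply/rowV0P => r /sub_kermxP /A0.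
Qed.

(** * Gram matrices, flips and adjoints of sesquilinear forms *)

Section Gram.
Variables (K : fieldType) (k : nat) (theta : {rmorphism K -> K}).
Variable sigma : {bilinear 'cV[K]_k -> 'cV[K]_k -> K | *%R & theta \; *%R}.

Definition gram : 'M[K]_k :=
  \matrix_(i, j) sigma (delta_mx i 0) (delta_mx j 0).

Lemma gramE x y : sigma x y = dot x (gram *m map_mx theta y).
Proof.
rewrite [x in LHS]matrix_sum_delta [y in LHS]matrix_sum_delta linear_sumlz.
rewrite dotE; apply: eq_bigr => i _; rewrite big_ord1 linearZl_LR /=.
rewrite mxE linear_sumr; congr (_ * _); apply: eq_bigr => j _.
by rewrite big_ord1 linearZr_LR !mxE mulrC.
Qed.

Lemma gram_unit : nondegenerate_form sigma -> gram \in unitmx.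
Proof.
move=> nd; rewrite -row_free_unit; apply/row_free_ker => r rM.
rewrite -[r]trmxK (nd r^T) ?trmx0 // => y.
by rewrite gramE /dot trmxK mulmxA rM mul0mx mxE.
Qed.

Lemma dual_basis : nondegenerate_form sigma ->
  exists x y : 'I_k -> 'cV[K]_k, forall i j, sigma (x i) (y j) = (i == j)%:R.
Proof.
move=> /gram_unit Mu.
exists (fun i => (row i (invmx gram))^T), (fun j => delta_mx j 0) => i j.
rewrite gramE /dot trmxK map_delta_mx mulmxA -row_mul mulVmx //.
by rewrite -colE !mxE.
Qed.

(* For x1, x2 and y1, y2 dual to each other, sigma (x1 + a x2) (y1 + b y2)
   vanishes iff a theta(b) = -1, and by reflexivity b theta(a) = -1 then. *)
Lemma reflexive_form_involutive : (1 < k)%N ->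
  nondegenerate_form sigma -> reflexive_form sigma -> involutive theta.
Proof.
move=> k1 /dual_basis[x [y xy]] refl b.
have [-> | b0] := eqVneq b 0; first by rewrite !rmorph0.
pose i1 := Ordinal (ltnW k1); pose i2 := Ordinal k1.
have yx12 : sigma (y i1) (x i2) = 0 by apply: refl; rewrite xy.
have yx21 : sigma (y i2) (x i1) = 0 by apply: refl; rewrite xy.
have sE a c : sigma (x i1 + a *: x i2) (y i1 + c *: y i2) = 1 + a * theta c.
  rewrite linearDl !linearDr !linearZl_LR !linearZr_LR /= !xy /=.
  by rewrite !mulr0 !mulr1 addr0 add0r.
have sE' a c : sigma (y i1 + c *: y i2) (x i1 + a *: x i2) =
    sigma (y i1) (x i1) + c * (theta a * sigma (y i2) (x i2)).
  rewrite linearDl !linearDr !linearZl_LR !linearZr_LR /= yx12 yx21.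
  by rewrite !mulr0 addr0 add0r.
(* For a = 1 and c = -1 the value in [sE] is 0 whatever theta is; reflexivity makes the value in
   [sE'] vanish too. *)
have d12 : sigma (y i1) (x i1) = sigma (y i2) (x i2).
  have := refl _ _ (_ : sigma (x i1 + 1 *: x i2) (y i1 + -1 *: y i2) = 0).
  rewrite sE sE' rmorphN !rmorph1 mul1r mulN1r subrr => /(_ erefl)/eqP.
  by rewrite mul1r subr_eq0 => /eqP.
have d0 : sigma (y i2) (x i2) != 0.
  by apply: contra_eq_neq (xy i2 i2) => /refl ->; rewrite eqxx eq_sym oner_eq0.
have := refl _ _ 
  (_ : sigma (x i1 + - (theta b)^-1 *: x i2) (y i1 + b *: y i2) = 0).
rewrite sE sE' mulNr mulVf ?fmorph_eq0 // subrr => /(_ erefl) /eqP.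
rewrite d12 mulrA -[X in X + _]mul1r -mulrDl mulf_eq0 (negPf d0).
rewrite orbF rmorphN fmorphV mulrN.
rewrite subr_eq0 => /eqP E.
have tb0 : theta (theta b) != 0 by rewrite !fmorph_eq0.
by rewrite -[LHS]mul1r E divfK.
Qed.

(** With M the Gram matrix, this is the solution phi of [phi^T M = theta(M)^T], which gives
    [sigma (phi x) y = theta (sigma y x)] once theta is involutive. *)
Definition flip_mx : 'M[K]_k := invmx gram^T *m map_mx theta gram.

Lemma rmorph_dot (x y : 'cV[K]_k) :
  theta (dot x y) = dot (map_mx theta x) (map_mx theta y).
Proof. by rewrite /dot map_trmx -map_mxM [RHS]mxE. Qed.

(* Stated for vectors so that it also holds, trivially, when k = 0. *)
Hypothesis theta_inv : involutive (@map_mx K K theta k 1).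

Lemma flipE x y : nondegenerate_form sigma ->
  sigma (flip_mx *m x) y = theta (sigma y x).
Proof.
move=> /gram_unit Mu; rewrite !gramE rmorph_dot map_mxM theta_inv.
rewrite -[X in dot _ (X *m _)]trmxK -dot_mull /flip_mx !mulmxA mulmxV ?mul1mx.
  by rewrite dotC.
by rewrite unitmx_tr.
Qed.

Lemma flip_unit : nondegenerate_form sigma -> flip_mx \in unitmx.
Proof.
move=> /gram_unit Mu.
by rewrite unitmx_mul unitmx_inv unitmx_tr Mu map_unitmx.
Qed.

(** The left adjoint of [Q]: the solution R of [R^T M = M theta(Q)], with M the Gram matrix. *)
Definition adjoint_mx (Q : 'M[K]_k) : 'M[K]_k :=
  (gram *m map_mx theta Q *m invmx gram)^T.

Lemma adjointE Q x y : nondegenerate_form sigma ->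
  sigma (adjoint_mx Q *m x) y = sigma x (Q *m y).
Proof.
move=> /gram_unit Mu; rewrite !gramE dot_mull trmxK mulmxA mulmxKV //.
by rewrite map_mxM mulmxA.
Qed.

Lemma adjoint_unit Q : nondegenerate_form sigma -> Q \in unitmx ->
  adjoint_mx Q \in unitmx.
Proof.
move=> /gram_unit Mu Qu.
by rewrite unitmx_tr !unitmx_mul Mu map_unitmx Qu unitmx_inv Mu.
Qed.

(** For k = 0 there are no entries to compare, for k = 1 involutivity is assumed, and for larger k
    it comes from reflexivity. *)
Lemma reflexive_map_involutive : nondegenerate_form sigma ->
  reflexive_form sigma -> (k = 1%N -> involutive theta) ->
  involutive (@map_mx K K theta k 1).
Proof.
move=> nd refl inv1 x; apply/matrixP => i j; rewrite !mxE.
have : (0 < k)%N by case: (k) i => // -[].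
rewrite leq_eqVlt => /predU1P[k1 | k1]; first exact: inv1 (esym k1) _.
exact: reflexive_form_involutive.
Qed.
End Gram.

(** * Spans and freeness of finitely indexed families *)

Section ImageSpan.
Variables (K : fieldType) (vT : vectType K) (m : nat) (f : 'I_m -> vT).

Local Notation ftuple := (map_tuple f (ord_tuple m)).

Lemma span_imageP v :
  reflect (exists c : 'I_m -> K, v = \sum_i c i *: f i)
          (v \in <<[seq f i | i : 'I_m]>>%VS).
Proof.
apply: (iffP idP) => [/(@coord_span _ _ _ ftuple) vE | [c ->]].
  exists (fun i => coord ftuple i v); rewrite {1}vE; apply: eq_bigr => i _.
  by rewrite -tnth_nth tnth_map tnth_ord_tuple.
by apply: memv_suml => i _; rewrite memvZ // memv_span // image_f.
Qed.

Lemma free_imageP :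
  reflect (forall c : 'I_m -> K, \sum_i c i *: f i = 0 -> forall i, c i = 0)
          (free [seq f i | i : 'I_m]).
Proof.
have E (c : 'I_m -> K) : \sum_i c i *: ftuple`_i = \sum_i c i *: f i.
  by apply: eq_bigr => i _; rewrite -tnth_nth tnth_map tnth_ord_tuple.
by apply: (iffP (@freeP _ _ _ ftuple)) => H c; have := H c; rewrite E.
Qed.
End ImageSpan.

Lemma mul_rowE (K : fieldType) m l (r : 'rV[K]_m) (G : 'M_(m, l)) :
  r *m G = \sum_i r 0 i *: row i G.
Proof. by rewrite -[in LHS](mulmx1 r) mulmx_sum_row mulmx1. Qed.

(** * F-spans of the columns of a matrix over L *)

Section Columns.
Variables (F : fieldType) (L : fieldExtType F) (k : nat).

Lemma mul_map_colE l (M : 'M[L]_(k, l)) (c : 'cV[F]_l) :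
  M *m map_mx (in_alg L) c = \sum_j c j 0 *: (col j M : fcol L k) :> fcol L k.
Proof.
apply/matrixP => i j; rewrite ord1 mxE summxE; apply: eq_bigr => a _.
by rewrite !mxE mulrC.
Qed.

Lemma span_fcolumnsP l (M : 'M[L]_(k, l)) v :
  reflect (exists c : 'cV[F]_l, v = M *m map_mx (in_alg L) c)
          (v \in <<fcolumns M>>%VS).
Proof.
apply: (iffP (span_imageP _ _)) => [[c vE] | [c vE]].
  exists (\col_j c j); rewrite mul_map_colE vE.
  by apply: eq_bigr => j _; rewrite mxE.
by exists (fun j => c j 0); rewrite vE mul_map_colE.
Qed.

Lemma sub_span_fcolumns l l' (M : 'M[L]_(k, l)) (M' : 'M[L]_(k, l')) :
  (forall j, (col j M' : fcol L k) \in <<fcolumns M>>%VS) ->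
  exists A : 'M[F]_(l, l'), M' = M *m map_mx (in_alg L) A.
Proof.
move=> sub; have {sub}/fin_all_exists[A AE] j := span_fcolumnsP _ _ (sub j).
exists (\matrix_(i, j) A j i 0); apply/matrixP => i j.
have /matrixP/(_ i 0) := AE j; rewrite !mxE => ->.
by apply: eq_bigr => a _; rewrite !mxE.
Qed.

(** F-independent columns allow left cancellation of [M] against matrices over F. This later shows
    that two base changes over F are mutually inverse. *)
Lemma free_fcolumns_inj l l' (M : 'M[L]_(k, l)) : free (fcolumns M) ->
  injective (fun A : 'M[F]_(l, l') => M *m map_mx (in_alg L) A).
Proof.
move=> /free_imageP Mfree A B AB; apply/matrixP => i j; apply/eqP.
rewrite -subr_eq0; apply/eqP.
suff /Mfree/(_ i) : \sum_a (A a j - B a j) *: (col a M : fcol L k) = 0 by [].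
have -> : \sum_a (A a j - B a j) *: (col a M : fcol L k) =
    M *m map_mx (in_alg L) (col j (A - B)).
  by rewrite mul_map_colE; apply: eq_bigr => a _; rewrite !mxE.
by rewrite map_col colE mulmxA map_mxB mulmxBr AB subrr mul0mx.
Qed.
(** Dual form of the spanning condition: no nonzero L-linear functional on L^k vanishes on all the
    [U i]. *)
Definition separating t (U : 'I_t -> {vspace fcol L k}) :=
  forall y : 'cV[L]_k, (forall i u, u \in U i -> dot u y = 0) -> y = 0.
End Columns.

(** * Orthogonal complements for the trace form *)

Section Complement.
Variables (F : finFieldType) (L : splittingFieldType F) (t k : nat).
Variable theta : {rmorphism L -> L}.
Variable sigma : {bilinear 'cV[L]_k -> 'cV[L]_k -> L | *%R & theta \; *%R}.
Hypothesis theta_inv : involutive (@map_mx L L theta k 1).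
Hypothesis sigma_nd : nondegenerate_form sigma.
Implicit Types U W : {vspace fcol L k}.

Local Notation tr := (galTrace 1%AS {:L}).

Lemma memv_ker_tr_dual (x y : fcol L k) :
  (x \in lker (tr_dual y)) = (tr (dot x y) == 0).
Proof. by rewrite memv_ker lfunE /= -trF_eq0. Qed.

(** The flipped value is [theta (sigma u v)]; theta commutes with the trace and is injective, so it
    can be stripped off. *)
Lemma trace_form_eq0C (u v : fcol L k) :
  trace_form sigma u v = 0 <-> trace_form sigma (flip_mx sigma *m v) u = 0.
Proof.
rewrite /trace_form flipE // -rmorph_tr.
by split=> [-> | /eqP]; rewrite ?rmorph0 // fmorph_eq0 => /eqP.
Qed.

(** The form is only semilinear in its second argument, so its vanishing is not directly the kernel
    of a linear map. After the flip [v] stands in the linear argument, and the complement is a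
    finite intersection of kernels. *)
Lemma orthogonal_complement_exists U :
  exists W, orthogonal_complement sigma U W.
Proof.
pose y u : fcol L k := (flip_mx sigma)^T *m (gram sigma *m map_mx theta u).
have yP u v : v \in lker (tr_dual (y u)) <-> trace_form sigma u v = 0.
  rewrite memv_ker_tr_dual -dot_mull -gramE.
  by apply: iff_trans (iff_sym (trace_form_eq0C u v)); split=> /eqP.
exists (\bigcap_(i < \dim U) lker (tr_dual (y (vbasis U)`_i)))%VS => v.
have E : (forall u, u \in U -> trace_form sigma u v = 0) <->
          (U <= lker (tr_dual ((gram sigma *m map_mx theta v) : fcol L k)))%VS.
  split=> [vU | /subvP vU u /vU]; last first.
    by rewrite memv_ker_tr_dual -gramE => /eqP.
  by apply/subvP => u /vU uv; rewrite memv_ker_tr_dual -gramE; apply/eqP.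
apply: iff_trans (iff_sym E); rewrite memvE.
(* By linearity in u it suffices to test a basis of [U]; only the [U] left of the inclusion becomes
   a span. *)
rewrite -[(U <= _)%VS](congr1 (fun X => X <= _)%VS (span_basis (vbasisP U))).
split=> [/subv_bigcapP vU | ].
  apply/span_subvP => _ /tnthP[i ->]; rewrite (tnth_nth 0).
  rewrite memv_ker_tr_dual -gramE; apply/eqP/yP.
  by rewrite memvE vU.
move/span_subvP=> vU; apply/subv_bigcapP => i _; rewrite -memvE; apply/yP/eqP.
rewrite /trace_form gramE -memv_ker_tr_dual.
by apply: vU; rewrite mem_nth // size_tuple.
Qed.

Lemma mem_complementK U W (u : fcol L k) : orthogonal_complement sigma U W ->
  u \in U <-> (forall v, v \in W -> trace_form sigma u v = 0).
Proof.
move=> UW; split=> [uU v /UW | uW]; first exact.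
apply: mem_biorthogonal => y yU.
(* As theta is involutive on vectors, every [y] is M theta(v) with M the Gram matrix, so dot
   products with [y] are values of sigma at [v]. *)
set v : fcol L k := map_mx theta (invmx (gram sigma) *m y).
have vE x : dot x y = sigma x v.
  by rewrite gramE theta_inv mulKVmx // gram_unit.
rewrite vE; apply: uW; apply/UW => w /yU.
by rewrite vE.
Qed.

(** If a nonzero [y] is dot-orthogonal to all [U' i], the [w] with [sigma w v = theta (dot v y)]
    spans an L-line which, by biorthogonality, lies in every [U i]. *)
Lemma complement_separating (U U' : 'I_t -> {vspace fcol L k}) :
  no_common_line U -> (forall i, orthogonal_complement sigma (U i) (U' i)) ->
  separating U'.
Proof.
move=> noline UU' y yU'; apply/eqP/idPn => y0; case: noline.
pose w : 'cV[L]_k := invmx (gram sigma)^T *m map_mx theta y.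
have wE v : sigma w v = theta (dot v y).
  rewrite gramE -[gram sigma]trmxK -dot_mull /w.
  rewrite mulKVmx ?unitmx_tr ?gram_unit //.
  by rewrite dotC rmorph_dot.
have w0 : w != 0.
  apply: contraNneq y0 => w0; rewrite -(theta_inv y).
  rewrite -[map_mx theta y](mulKVmx (_ : (gram sigma)^T \in unitmx)) -/w.
    by rewrite w0 mulmx0 map_mx0.
  by rewrite unitmx_tr gram_unit.
exists <[w]>%VS => [|_ /vlineP[a ->] i]; first by rewrite dim_vline w0.
apply/(mem_complementK _ (UU' i)) => v /yU' vy.
by rewrite /trace_form linearZl_LR /= wE vy rmorph0 mulr0 raddf0.
Qed.

(** On an L-line inside [U' i] the trace form against [u] vanishes for all scalings, hence so does
    sigma itself; then M theta(w), for w on the line, is dot-orthogonal to every [U i]. *)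
Lemma complement_no_common_line (U U' : 'I_t -> {vspace fcol L k}) :
  separating U -> (forall i, orthogonal_complement sigma (U i) (U' i)) ->
  no_common_line U'.
Proof.
move=> sepU UU' [W dimW WU']; suff w0 : vpick W = 0.
  by move: dimW; rewrite (eqP (_ : W == 0%VS)) ?dimv0 // -vpick0 w0.
suff Mw0 : gram sigma *m map_mx theta (vpick W) = 0.
  rewrite -[LHS]theta_inv.
  rewrite -[map_mx theta (vpick W)](mulKmx (gram_unit sigma_nd)) Mw0.
  by rewrite mulmx0 map_mx0.
apply: sepU => i u uU; rewrite -gramE; apply: tr_nondeg => c.
have /WU'/(_ i)/UU' /(_ u uU) : theta c *: vpick W \in W.
  by rewrite memvZ ?memv_pick.
(* Involutivity is available on vectors only, so [theta (theta c)] is simplified through the vector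
   it multiplies. *)
have thetaZ : map_mx theta (theta c *: vpick W) = c *: map_mx theta (vpick W).
  by rewrite -[in LHS](theta_inv (vpick W)) -map_mxZ theta_inv.
by rewrite /trace_form !gramE thetaZ -scalemxAr dotZr.
Qed.

(** The flip moves [w] to the left argument, the adjoint then carries [Q] across, and what remains
    is biorthogonality of [U]. *)
Lemma mem_double_complement U U' U2 U2' (Q : 'M[L]_k) :
  orthogonal_complement sigma U U' -> orthogonal_complement sigma U2 U2' ->
  (forall v : 'cV_k, v \in U2 <-> exists2 u : 'cV_k, u \in U' & v = Q *m u) ->
  forall w : 'cV_k,
    w \in U2' <-> adjoint_mx sigma Q *m (flip_mx sigma *m w) \in U.
Proof.
move=> UU' U2U2' U2E w.
have E u : trace_form sigma (adjoint_mx sigma Q *m (flip_mx sigma *m w)) u = 0 <->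
           trace_form sigma (Q *m u) w = 0.
  apply: iff_sym; apply: iff_trans (trace_form_eq0C _ _) _.
  by rewrite /trace_form adjointE.
split=> [/U2U2' w0 | /(mem_complementK _ UU') w0].
  by apply/(mem_complementK _ UU') => u uU'; apply/E/w0/U2E; exists u.
by apply/U2U2' => _ /U2E[u uU' ->]; apply/E/w0.
Qed.
End Complement.

(** * Row spaces, generator matrices and codes of systems *)

Section Rows.
Variables (K : fieldType) (m l : nat) (G : 'M[K]_(m, l)).

Lemma span_rowsP (v : 'rV_l) :
  reflect (exists r : 'rV_m, v = r *m G)
          (v \in <<[seq row i G | i : 'I_m]>>%VS).
Proof.
apply: (iffP (span_imageP _ _)) => [[c ->] | [r ->]].
  by exists (\row_i c i); rewrite mul_rowE; apply: eq_bigr => i _; rewrite mxE.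
by exists (r 0); rewrite mul_rowE.
Qed.

Lemma free_rows : free [seq row i G | i : 'I_m] = row_free G.
Proof.
apply/free_imageP/idP => [Gfree | /row_free_ker Gker c cG i].
  apply/row_free_ker => r rG; apply/rowP => i; rewrite mxE.
  apply: (Gfree (r 0)).
  by rewrite -mul_rowE.
suff /rowP/(_ i) : \row_i c i = 0 by rewrite !mxE.
by apply: Gker; rewrite mul_rowE -[RHS]cG; apply: eq_bigr => a _; rewrite mxE.
Qed.
End Rows.

Section Codes.
Variables (F : fieldType) (L : fieldExtType F) (t k : nat).

Lemma generator_matrixP (n : 'I_t -> nat) (G : 'M[L]_(k, \sum_i n i))
    (C : {vspace ambient L n}) :
  generator_matrix G C <->
  row_free G /\ (forall v, v \in C <-> exists r : 'rV_k, v = r *m G).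
Proof.
rewrite /generator_matrix /basis_of free_rows.
split=> [/andP[/eqP <- ->] | [-> CE]].
  by split=> // v; split=> /span_rowsP.
rewrite andbT; apply/eqP/vspaceP => v.
by apply/span_rowsP/idP => /CE.
Qed.

Lemma generator_matrix_base_change (n : 'I_t -> nat) (G H : 'M[L]_(k, \sum_i n i))
    (C : {vspace ambient L n}) :
  generator_matrix G C -> generator_matrix H C ->
  exists2 Q, Q \in unitmx & H = Q *m G.
Proof.
move=> /generator_matrixP[_ CG] /generator_matrixP[Hfree CH].
have /fin_all_exists[Q HQ] i : exists r : 'rV_k, row i H = r *m G.
  by apply/CG/CH; exists (delta_mx 0 i); rewrite rowE.
have HE : H = (\matrix_i Q i) *m G.
  by apply/row_matrixP => i; rewrite HQ row_mul rowK.
exists (\matrix_i Q i) => //; rewrite -row_free_unit.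
apply/row_free_ker => r rQ.
by move/row_free_ker: Hfree; apply; rewrite HE mulmxA rQ mul0mx.
Qed.

(** A [y] orthogonal to every [U i] is orthogonal to all columns of [G], so [y^T G = 0], and the
    rows of [G] are independent. *)
Lemma generator_separating (n : 'I_t -> nat) (G : 'M[L]_(k, \sum_i n i))
    (C : {vspace ambient L n}) (U : 'I_t -> {vspace fcol L k}) :
  generator_matrix G C -> (forall i, U i = <<fcolumns (submxrow G i)>>%VS) ->
  separating U.
Proof.
move=> /generator_matrixP[/row_free_ker Gker _] UE y yU.
rewrite -[y]trmxK (Gker y^T) ?trmx0 //; apply/mxrowP => i.
rewrite -mul_submxrow submxrow0; apply/rowP => j; rewrite [RHS]mxE.
transitivity (dot (col j (submxrow G i)) y); last first.
  by apply: (yU i); rewrite UE memv_span // image_f.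
by rewrite dotC dotE [LHS]mxE; apply: eq_bigr => a _; rewrite !mxE.
Qed.

Lemma separating_fullv (U : 'I_t -> {vspace fcol L k}) (W : {vspace 'cV[L]_k}) :
  separating U -> (forall i v, v \in U i -> v \in W) -> W = fullv.
Proof.
(* The columns of [X] are an L-basis of [W]; separation makes its k rows independent, which forces k
   <= dim W. *)
move=> sepU UW; pose X := \matrix_(i < k, j < \dim W) (vbasis W)`_j i 0.
have : row_free X.
  apply/row_free_ker => r rX; rewrite -[r]trmxK (sepU r^T) ?trmx0 //.
  move=> i u /UW uW.
  have -> : u = X *m \col_j coord (vbasis W) j u.
    rewrite [LHS](coord_vbasis uW); apply/matrixP => a b.
    rewrite ord1 mxE summxE.
    by apply: eq_bigr => j _; rewrite !mxE mulrC.
  by rewrite dotC /dot trmxK mulmxA rX mul0mx mxE.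
rewrite /row_free => /eqP rX; apply/eqP; rewrite eqEdim subvf dimvf.
by apply: leq_trans (eq_leq (muln1 k)) _; rewrite -{1}rX rank_leq_col.
Qed.

(** Bases of the [U i] are put side by side; a left kernel vector of the result would be orthogonal
    to every [U i]. *)
Lemma system_exists (U : 'I_t -> {vspace fcol L k}) : separating U ->
  exists (n : 'I_t -> nat) (C : {vspace ambient L n}),
    is_system n U /\ code_of_system U C.
Proof.
move=> sepU; pose n i := \dim (U i).
pose B i : 'M[L]_(k, n i) := \matrix_(a, j) ((vbasis (U i))`_j : 'cV_k) a 0.
pose G := \mxrow_i B i.
have colE i : fcolumns (submxrow G i) = vbasis (U i).
  rewrite mxrowK; apply: (@eq_from_nth _ 0) => [|j].
    by rewrite size_map size_enum_ord size_tuple.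
  rewrite size_map size_enum_ord => jn.
  rewrite (nth_map (Ordinal jn)) ?size_enum_ord //; apply/matrixP => a b.
  by rewrite ord1 !mxE nth_enum_ord.
have Gfree : row_free G.
  apply/row_free_ker => r rG; rewrite -[r]trmxK (sepU r^T) ?trmx0 // => i u.
  rewrite -(span_basis (vbasisP (U i))) -colE => /span_fcolumnsP[c ->].
  by rewrite dotC /dot trmxK mulmxA mul_submxrow rG submxrow0 mul0mx mxE.
exists n, <<[seq row i G | i : 'I_k]>>%VS; split.
  by split=> // W; apply: separating_fullv.
exists G => [|i]; last by rewrite colE vbasisP.
by rewrite /generator_matrix /basis_of eqxx free_rows.
Qed.
End Codes.

(** * Blockwise maps over F and equivalence of codes *)

Section Equivalence.
Variables (F : fieldType) (L : fieldExtType F).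

Lemma map_in_alg1 n : map_mx (in_alg L) (1%:M : 'M[F]_n) = 1%:M.
Proof. exact: map_mx1. Qed.

Lemma rank_weight_mul_le l l' (x : 'rV[L]_l) (A : 'M[F]_(l, l')) :
  (rank_weight (x *m map_mx (in_alg L) A) <= rank_weight x)%N.
Proof.
apply/dimvS/span_subvP => _ /imageP[j _ ->]; rewrite mxE.
apply: memv_suml => i _; rewrite mxE -mulrC mulr_algl memvZ // memv_span //.
exact: image_f.
Qed.

Lemma rank_weight_mul l l' (x : 'rV[L]_l) (A : 'M[F]_(l, l')) B :
  A *m B = 1%:M -> rank_weight (x *m map_mx (in_alg L) A) = rank_weight x.
Proof.
move=> AB; apply/eqP; rewrite eqn_leq rank_weight_mul_le /=.
rewrite -{1}[x]mulmx1 -[1%:M]map_in_alg1 -AB map_mxM mulmxA.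
exact: rank_weight_mul_le.
Qed.

(** The two casts cancel. Their proofs [h] and [h0] may differ, and are identified by uniqueness of
    identity proofs on nat. *)
Lemma castmx_mul_map l l' (h h0 : l = l') (x : 'rV[L]_l) (A : 'M[F]_(l, l')) :
  castmx (erefl 1%N, h) x *m map_mx (in_alg L) (castmx (h0, erefl l') A) =
  x *m map_mx (in_alg L) A.
Proof. by case: l' / h A h0 => A h0; rewrite (eq_axiomK h0) !castmx_id. Qed.

Lemma castmx_unit l l' (h : l = l') (A : 'M[F]_(l, l')) B :
  A *m B = 1%:M -> castmx (h, erefl l') A \in unitmx.
Proof. by case: l' / h A B => A B /mulmx1_unit[]; rewrite castmx_id. Qed.

Section BlockMap.
Variables (t : nat) (n n' : 'I_t -> nat).

(** The blocks are rectangular because [n i = n' i] is derived only later, from two-sided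
    invertibility. *)
Definition block_map (A : forall i, 'M[F]_(n i, n' i)) (x : ambient L n) :
    ambient L n' :=
  \mxrow_i (submxrow x i *m map_mx (in_alg L) (A i)).

Fact block_map_is_linear A : linear (block_map A).
Proof.
move=> a x y; apply/mxrowP => i; rewrite submxrowD mxrowK.
have subZ n0 (z : ambient L n0) : submxrow (a *: z) i = a *: submxrow z i.
  by apply/matrixP => b j; rewrite !mxE.
by rewrite submxrowD !subZ !mxrowK mulmxDl -scalemxAl.
Qed.
HB.instance Definition _ A :=
  GRing.isLinear.Build L (ambient L n) (ambient L n') _ (block_map A)
    (block_map_is_linear A).
End BlockMap.

Lemma block_mapK t (n n' : 'I_t -> nat) (A : forall i, 'M[F]_(n i, n' i))
    (B : forall i, 'M[F]_(n' i, n i)) :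
  (forall i, A i *m B i = 1%:M) -> cancel (block_map A) (block_map B).
Proof.
move=> AB x; apply/mxrowP => i; rewrite !mxrowK -mulmxA -map_mxM AB.
by rewrite map_in_alg1 mulmx1.
Qed.

Lemma block_map_isometry_form t (n n' : 'I_t -> nat)
    (A : forall i, 'M[F]_(n i, n' i)) (B : forall i, 'M[F]_(n' i, n i)) :
  (forall i, A i *m B i = 1%:M) -> (forall i, B i *m A i = 1%:M) ->
  isometry_form (block_map A).
Proof.
move=> AB BA.
have nn' i : n i = n' i.
  by apply/eqP; rewrite eqn_leq (mulmx1_min (AB i)) (mulmx1_min (BA i)).
have hs i : n ((1%g : 'S_t) i) = n' i by rewrite perm1.
exists 1%g, hs, (fun=> 1), (fun i => castmx (nn' i, erefl (n' i)) (A i)).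
split=> [i | i | x i]; first exact: oner_neq0.
  exact: castmx_unit (AB i).
(* The type of [hs i] mentions [1%g i], so it is generalised before [perm1] can rewrite under the
   cast. *)
rewrite scale1r mxrowK; move: (hs i); rewrite perm1 => h.
by rewrite castmx_mul_map.
Qed.

(** The block map sends [r Q G] to [r G'], and the invertible [Q] merely changes the basis of
    [C]. *)
Lemma equivalent_codes_block t k (n n' : 'I_t -> nat)
    (C : {vspace ambient L n}) (C' : {vspace ambient L n'})
    (G : 'M[L]_(k, \sum_i n i)) (G' : 'M[L]_(k, \sum_i n' i)) (Q : 'M[L]_k)
    (A : forall i, 'M[F]_(n i, n' i)) (B : forall i, 'M[F]_(n' i, n i)) :
  generator_matrix G C -> generator_matrix G' C' -> Q \in unitmx ->
  (forall i, A i *m B i = 1%:M) -> (forall i, B i *m A i = 1%:M) ->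
  (forall i, submxrow G' i = Q *m submxrow G i *m map_mx (in_alg L) (A i)) ->
  equivalent_codes C C'.
Proof.
move=> /generator_matrixP[_ CG] /generator_matrixP[_ CG'] Qu AB BA G'E.
have mapE r : block_map A (r *m Q *m G) = r *m G'.
  by apply/mxrowP => i; rewrite mxrowK -!mul_submxrow G'E !mulmxA.
exists (linfun (block_map A)); split.
- exists (block_map B) => x; rewrite lfunE /= block_mapK //.
- move=> x; rewrite lfunE; apply: eq_bigr => i _.
  by rewrite mxrowK (rank_weight_mul _ (AB i)).
- have [s [hs [a [P [a0 Pu fE]]]]] := block_map_isometry_form AB BA.
  by exists s, hs, a, P; split=> // x i; rewrite lfunE fE.
apply/vspaceP => v; apply/memv_imgP/idP => [[u /CG[r ->] ->] | /CG'[r ->]].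
  by apply/CG'; exists (r *m invmx Q); rewrite lfunE -mapE mulmxKV.
by exists (r *m Q *m G); [apply/CG; exists (r *m Q) | rewrite lfunE /= mapE].
Qed.
End Equivalence.

(** * The geometric dual and the double dual *)

Section Dual.
Variables (F : finFieldType) (L : splittingFieldType F) (t k : nat).
Variable theta : {rmorphism L -> L}.
Variable sigma : {bilinear 'cV[L]_k -> 'cV[L]_k -> L | *%R & theta \; *%R}.
Hypothesis theta_inv : involutive (@map_mx L L theta k 1).
Hypothesis sigma_nd : nondegenerate_form sigma.

Lemma geometric_dual_exists (n : 'I_t -> nat) (C : {vspace ambient L n})
    (U : 'I_t -> {vspace fcol L k}) :
  system_of_code C U -> no_common_line U ->
  exists (n' : 'I_t -> nat) (D : {vspace ambient L n'}),
    geometric_dual sigma C D.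
Proof.
move=> CU noline.
have /fin_all_exists[U' UU'] i :=
  orthogonal_complement_exists theta_inv sigma_nd (U i).
have [n' [D [sysU' DU']]] :=
  system_exists (complement_separating theta_inv sigma_nd noline UU').
by exists n', D, U, U'.
Qed.

(** This makes [D] eligible for a second dual: the complements share no L-line because the original
    system spans. *)
Lemma geometric_dual_system (n n' : 'I_t -> nat)
    (C : {vspace ambient L n}) (D : {vspace ambient L n'}) :
  geometric_dual sigma C D ->
  exists2 U' : 'I_t -> {vspace fcol L k}, system_of_code D U' &
    no_common_line U'.
Proof.
move=> [U [U' [[G GC UG] _ UU' _ [H HD U'H]]]]; exists U'.
  by exists H => // i; rewrite (span_basis (U'H i)).
apply: (complement_no_common_line theta_inv sigma_nd _ UU').
exact: generator_separating GC UG.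
Qed.

Lemma double_geometric_dual_equivalent (n n' n'' : 'I_t -> nat)
    (C : {vspace ambient L n}) (D : {vspace ambient L n'})
    (E : {vspace ambient L n''}) :
  nondegenerate_code k C -> geometric_dual sigma C D ->
  geometric_dual sigma D E ->
  equivalent_codes E C.
Proof.
move=> Cnd [U [U' [[G GC UG] _ UU' _ [H HD U'H]]]].
move=> [U2 [U2' [[H2 H2D U2H2] _ UU2 _ [G2 G2E U2'G2]]]].
(* The second dual may start from another generator matrix of [D] than the one the first
   produced. *)
have [Q Qu H2E] := generator_matrix_base_change HD H2D.
pose P := adjoint_mx sigma Q *m flip_mx sigma.
have Pu : P \in unitmx by rewrite unitmx_mul adjoint_unit ?flip_unit.
have mem_U2' i (w : 'cV_k) : w \in U2' i <-> P *m w \in U i.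
  rewrite -mulmxA; apply: mem_double_complement (UU' i) (UU2 i) _ w => // v.
  rewrite U2H2 -(span_basis (U'H i)) H2E -mul_submxrow.
  split=> [/span_fcolumnsP[c ->] | [u /span_fcolumnsP[c ->] ->]].
    exists (submxrow H i *m map_mx (in_alg L) c); last by rewrite mulmxA.
    by apply/span_fcolumnsP; exists c.
  by apply/span_fcolumnsP; exists c; rewrite mulmxA.
(* [A] writes the columns of P^-1 G in the double dual system, and [B] those of P G2 in the original
   one. *)
have /fin_all_exists[A AE] i : exists A : 'M[F]_(n'' i, n i),
    invmx P *m submxrow G i = submxrow G2 i *m map_mx (in_alg L) A.
  apply: sub_span_fcolumns => j; rewrite (span_basis (U2'G2 i)); apply/mem_U2'.
  rewrite colE !mulmxA mulmxV // mul1mx -colE UG.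
  by apply: memv_span; exact: image_f.
have /fin_all_exists[B BE] i : exists B : 'M[F]_(n i, n'' i),
    P *m submxrow G2 i = submxrow G i *m map_mx (in_alg L) B.
  apply: sub_span_fcolumns => j; rewrite -UG colE -mulmxA -colE; apply/mem_U2'.
  by rewrite -(span_basis (U2'G2 i)); apply: memv_span; exact: image_f.
have GE i : submxrow G i = P *m submxrow G2 i *m map_mx (in_alg L) (A i).
  by rewrite -mulmxA -AE mulKVmx.
(* [A] and [B] are mutually inverse: cancel [G2], whose block columns are bases, then [G], using
   nondegeneracy of [C]. *)
apply: (equivalent_codes_block G2E GC Pu (A := A) (B := B)) => // i.
  apply: (free_fcolumns_inj (basis_free (U2'G2 i))).
  by rewrite /= map_mxM map_in_alg1 mulmx1 mulmxA -AE -mulmxA -BE mulKmx.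
apply: (free_fcolumns_inj (Cnd G GC i)).
by rewrite /= map_mxM map_in_alg1 mulmx1 mulmxA -BE -GE.
Qed.
End Dual.

(** The existence clauses keep the final equivalence, which ranges over all choices of duals, from
    being vacuous. *)
Theorem proposition3p6 (F : finFieldType) (L : splittingFieldType F)
    (t k : nat) (n : 'I_t -> nat)
    (theta : {rmorphism L -> L})
    (sigma : {bilinear 'cV[L]_k -> 'cV[L]_k -> L | *%R & theta \; *%R})
    (sigma_nondeg : nondegenerate_form sigma)
    (sigma_refl : reflexive_form sigma)
    (theta_inv : k = 1%N -> involutive theta)
    (C : {vspace ambient L n}) (U : 'I_t -> {vspace fcol L k})
    (dimC : \dim C = k)
    (C_nondeg : nondegenerate_code k C)
    (CU : system_of_code C U)
    (U_noline : no_common_line U) :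
  (exists (n' : 'I_t -> nat) (D : {vspace ambient L n'}),
     geometric_dual sigma C D) /\
  (forall (n' : 'I_t -> nat) (D : {vspace ambient L n'}),
     geometric_dual sigma C D ->
     (exists (n'' : 'I_t -> nat) (E : {vspace ambient L n''}),
        geometric_dual sigma D E) /\
     (forall (n'' : 'I_t -> nat) (E : {vspace ambient L n''}),
        geometric_dual sigma D E -> equivalent_codes E C)).
Proof.
have theta_map := reflexive_map_involutive sigma_nondeg sigma_refl theta_inv.
split; first exact: geometric_dual_exists CU U_noline.
move=> n' D CD.
have [U' DU' U'_noline] := geometric_dual_system theta_map sigma_nondeg CD.
split; first exact: geometric_dual_exists DU' U'_noline.
by move=> n'' E DE; apply: double_geometric_dual_equivalent CD DE.
Qed.
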